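(* For a semigroup $S$ the following conditions are equivalent: (1) $S$ is a right regular semigroup; (2) for every intuitionistic fuzzy right ideal $A=(\mu_A,\nu_A)$ of $S$, the intuitionistic fuzzy magnified translation $A^C_{\beta\alpha}=((\mu_A)^C_{\beta\alpha},(\nu_A)^C_{\beta\alpha})$ of $A$ (where $\beta\in(0,1]$ and $\alpha\in[0,\inf\{\beta\nu_A(x):x\in S\}]$) is an intuitionistic fuzzy semiprime ideal of $S$.
   Context: A semigroup is a non-empty set with an associative binary operation. $S$ is right regular if for each $a\in S$ there exists $x\in S$ with $a=a^2x$. An intuitionistic fuzzy subset of $S$ is a pair $A=(\mu_A,\nu_A)$ of functions $\mu_A,\nu_A:S\to[0,1]$ with $0\le\mu_A(x)+\nu_A(x)\le1$ for all $x\in S$; it is non-empty if it is not the empty one ($\mu_A\equiv0$, $\nu_A\equiv1$). For $\beta\in(0,1]$ and $\alpha\in[0,\inf\{\beta\nu_A(x):x\in S\}]$, the intuitionistic fuzzy magnified translation of $A$ is $A^C_{\beta\alpha}=((\mu_A)^C_{\beta\alpha},(\nu_A)^C_{\beta\alpha})$ with $(\mu_A)^C_{\beta\alpha}(x)=\beta\mu_A(x)+\alpha$ and $(\nu_A)^C_{\beta\alpha}(x)=\beta\nu_A(x)-\alpha$ for all $x\in S$. A non-empty intuitionistic fuzzy subset $A$ of $S$ is an intuitionistic fuzzy left ideal if $\mu_A(xy)\ge\mu_A(y)$ and $\nu_A(xy)\le\nu_A(y)$ for all $x,y\in S$, and an intuitionistic fuzzy right ideal if $\mu_A(xy)\ge\mu_A(x)$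 and $\nu_A(xy)\le\nu_A(x)$ for all $x,y\in S$. It is an intuitionistic fuzzy ideal (two-sided) if it is both an intuitionistic fuzzy left ideal and an intuitionistic fuzzy right ideal. An intuitionistic fuzzy ideal $A$ of $S$ is an intuitionistic fuzzy semiprime ideal if $\mu_A(x)\ge\mu_A(x^2)$ and $\nu_A(x)\le\nu_A(x^2)$ for all $x\in S$.
   Formalization: In (2), ''intuitionistic fuzzy semiprime ideal'' is taken as a right ideal satisfying the semiprime inequalities, not a two-sided ideal; with two-sided ideals, (1)⇒(2) fails for the left zero semigroup xy = x on two elements. *)

(* Defs.v *)
From HB Require Import structures.
From mathcomp Require Import all_boot all_order all_algebra.
From mathcomp Require Import all_classical all_reals.

Set Implicit Arguments.
Unset Strict Implicit.
Unset Printing Implicit Defensive.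

Import Order.TTheory GRing.Theory Num.Theory.

Local Open Scope classical_set_scope.
Local Open Scope ring_scope.

Definition right_regular (S : semigroupType) : Prop :=
  forall a : S, exists x : S, a = (a * a * x)%g.

(* A bare pair of functions; the constraints are in [intuitionistic_fuzzy]. *)
Record if_pair (R : realType) (S : Type) : Type :=
  IFPair { mu : S -> R ; nu : S -> R }.

Definition intuitionistic_fuzzy (R : realType) (S : Type)
    (A : if_pair R S) : Prop :=
  forall x : S, [/\ 0 <= mu A x <= 1, 0 <= nu A x <= 1
                  & 0 <= mu A x + nu A x <= 1].

Definition if_nonempty (R : realType) (S : Type) (A : if_pair R S) : Prop :=
  ~ (forall x : S, mu A x = 0 /\ nu A x = 1).

Definition if_right_ideal (R : realType) (S : semigroupType)
    (A : if_pair R S) : Prop :=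
  [/\ intuitionistic_fuzzy A, if_nonempty A
    & forall x y : S, mu A x <= mu A (x * y)%g /\ nu A (x * y)%g <= nu A x].

Definition if_semiprime (R : realType) (S : semigroupType)
    (A : if_pair R S) : Prop :=
  forall x : S, mu A (x * x)%g <= mu A x /\ nu A x <= nu A (x * x)%g.

(* Semiprimeness of a one-sided ideal. It must not be replaced by semiprimeness
   of a two-sided ideal in the characterization of right regularity: a left zero
   semigroup (x * y = x) is right regular, and all its non-empty intuitionistic
   fuzzy subsets are right ideals, but only the constant ones are left ideals. *)
Definition if_semiprime_right_ideal (R : realType) (S : semigroupType)
    (A : if_pair R S) : Prop :=
  if_right_ideal A /\ if_semiprime A.

Definition magnified_translation (R : realType) (S : Type)
    (beta alpha : R) (A : if_pair R S) : if_pair R S :=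
  IFPair (fun x => beta * mu A x + alpha) (fun x => beta * nu A x - alpha).

(* Main.v *)
Require Import Defs.
From HB Require Import structures.
From mathcomp Require Import all_boot all_order all_algebra.
From mathcomp Require Import all_classical all_reals.
From mathcomp Require Import lra.

Import Order.TTheory GRing.Theory Num.Theory.

Local Open Scope classical_set_scope.
Local Open Scope ring_scope.

(** If [S] is right regular, then [a = a^2 x] bounds every fuzzy right ideal at
    [a] by its value at [a^2], and magnified translations preserve fuzzy right
    ideals because [alpha] is at most [beta * nu A x] for all [x].  Conversely,
    take [beta = 1], [alpha = 0] and the characteristic pair of the principal
    right ideal generated by [a^2]: semiprimeness puts [a] in this ideal, so [a]
    is [a^2] or [a^2 x], and [a = a^2] gives [a = a^2 a]. *)

Lemma if_right_ideal_magnified_translation (R : realType) (S : semigroupType)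
    (A : if_pair R S) (beta alpha : R) :
  0 < beta <= 1 -> 0 <= alpha -> (forall x, alpha <= beta * nu A x) ->
  if_right_ideal A -> if_right_ideal (magnified_translation beta alpha A).
Proof.
move=> /andP[b0 b1] a0 le_alpha [fuzA neA ideA]; split.
- move=> x /=; have [/andP[m0 m1] /andP[n0 n1] /andP[s0 s1]] := fuzA x.
  (* The upper bounds come from [beta * mu A x + alpha <= beta * (mu A x + nu A x) <= beta <= 1]. *)
  have := le_alpha x; split; apply/andP; split; nra.
(* [beta * mu A x + alpha = 0] has non-negative terms and [0 < beta], and
   [1 <= beta * nu A x <= nu A x]. *)
- move=> emptyA; apply: neA => x; have /= [m0 n1] := emptyA x.
  have [/andP[mu0 _] /andP[nu0 nu1] _] := fuzA x.
  split; apply: le_anti; apply/andP; split; nra.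
- move=> x y /=; have [lemu lenu] := ideA x y.
  by rewrite lerD2r lerB // ler_pM2l.
Qed.

Lemma right_regular_semiprime (R : realType) (S : semigroupType)
    (A : if_pair R S) :
  right_regular S -> if_right_ideal A -> if_semiprime A.
Proof.
move=> regS [_ _ ideA] x; have [y xE] := regS x.
by have := ideA (x * x)%g y; rewrite -xE.
Qed.

Definition if_char (R : realType) (S : Type) (I : set S) : if_pair R S :=
  IFPair (fun x => (x \in I)%:R) (fun x => (x \notin I)%:R).

Lemma if_right_ideal_char (R : realType) (S : semigroupType) (I : set S) :
  I !=set0 -> (forall x y, I x -> I (x * y)%g) ->
  if_right_ideal (if_char R S I).
Proof.
move=> [a Ia] ideI; split.
- by move=> x /=; case: (x \in I); split; rewrite /= ?addr0 ?add0r ?lexx ?ler01.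
- move=> /(_ a) /= []; rewrite (mem_set Ia) => /eqP.
  by rewrite oner_eq0.
- move=> x y /=; have [/set_mem Ix|nIx] := boolP (x \in I).
    by rewrite (mem_set (ideI _ y Ix)).
  (* Off [I] the pair takes its extreme values 0 and 1. *)
  by rewrite ler_nat leq0n ler_nat leq_b1.
Qed.

Theorem theorem3p20 (R : realType) (S : semigroupType) (S_nonempty : inhabited S) :
  right_regular S <->
  (forall A : if_pair R S, if_right_ideal A ->
   forall beta alpha : R,
     beta \in `]0, 1] ->
     alpha \in `[0, inf [set beta * nu A x | x in [set: S]]] ->
     if_semiprime_right_ideal (magnified_translation beta alpha A)).
Proof.
split=> [regS A idA beta alpha|semiprimeS a].
  rewrite !in_itv /= => b01 /andP[a0 a_inf]; have [b0 _] := andP b01.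
  have idT : if_right_ideal (magnified_translation beta alpha A).
    apply: if_right_ideal_magnified_translation => // x.
    apply: le_trans a_inf _; apply: ge_inf; last by exists x.
    (* The infimum is a lower bound only once the set is known to be bounded below; 0 serves. *)
    exists 0 => _ [y _ <-]; have [fuzA _ _] := idA.
    by have [_ /andP[n0 _] _] := fuzA y; rewrite mulr_ge0 // ltW.
  by split=> //; apply: right_regular_semiprime.
(* [S] may lack an identity, so [a * a] is adjoined to its right multiples. *)
pose I := [set z | z = (a * a)%g \/ exists y, z = (a * a * y)%g].
have Iaa : I (a * a)%g by left.
have idI : if_right_ideal (if_char R S I).
  apply: if_right_ideal_char; first by exists (a * a)%g.
  move=> x y [->|[z ->]]; right; first by exists y.
  by exists (z * y)%g; rewrite !mulgA.
have [||_ /(_ a) /= []] := semiprimeS _ idI 1 0.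
- by rewrite in_itv /= ltr01 lexx.
- rewrite in_itv /= lexx; apply: lb_le_inf.
    by exists (1 * nu (if_char R S I) a); exists a.
  by move=> _ [y _ <-] /=; rewrite mul1r ler0n.
(* Since [I] contains [a * a], semiprimeness reads [1 <= (a \in I)%:R]. *)
rewrite !addr0 !mul1r (mem_set Iaa) ler_nat lt0b => /set_mem [aE|//] _.
by exists a; rewrite -aE.
Qed.
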